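(* Let $W(x,y)$ be an $xy$-symmetric weight function defined on a domain $\Omega\subset\mathbb{R}^2$, and let $\{\mathbb{S}_n\}_{n\geqslant 0}$ be the ($xy$-symmetric) monic orthogonal polynomial system associated with $W$. Let $\{\mathbb{P}_n^{(i,j)}\}_{n\geqslant0}$, $i,j\in\{0,1\}$, be the big vector polynomials associated with $\{\mathbb{S}_n\}_{n\geqslant0}$, i.e. those determined by $$\mathbb{S}_{2n}(x,y)=\mathbb{P}_n^{(0,0)}(x^2,y^2)+x\,y\,\mathbb{P}_{n-1}^{(1,1)}(x^2,y^2),\qquad \mathbb{S}_{2n+1}(x,y)=x\,\mathbb{P}_n^{(1,0)}(x^2,y^2)+y\,\mathbb{P}_n^{(0,1)}(x^2,y^2),$$ and put $\widehat{\mathbb{P}}_n^{(i,j)}=\mathrm{J}_n^{(i,j)}\,\mathbb{P}_n^{(i,j)}$ for $n\geqslant0$. Let $\Omega^*=\{(x,y)\in\mathbb{R}^2: x,y\geqslant0,\ (\sqrt{x},\sqrt{y})\in\Omega\}$. Then, for $i,j\in\{0,1\}$, the family $\{\widehat{\mathbb{P}}_n^{(i,j)}\}_{n\geqslant0}$ is the monic orthogonal polynomial system associated with the weight function $W^{(i,j)}$ on $\Omega^*$, where \begin{align*} W^{(0,0)}(x,y)&=\frac14\,\frac{1}{\sqrt{xy}}\,W(\sqrt{x},\sqrt{y}),\\ W^{(1,0)}(x,y)&=\frac14\,\sqrt{\frac{x}{y}}\,W(\sqrt{x},\sqrt{y})=x\,W^{(0,0)}(x,y),\\ W^{(0,1)}(x,y)&=\frac14\,\sqrt{\frac{y}{x}}\,W(\sqrt{x},\sqrt{y})=y\,W^{(0,0)}(x,y),\\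 W^{(1,1)}(x,y)&=\frac14\,\sqrt{xy}\,W(\sqrt{x},\sqrt{y})=xy\,W^{(0,0)}(x,y). \end{align*}
   Context: Weight function on $\Omega\subset\mathbb{R}^2$: a nonnegative function $W$ on $\Omega$ with positive integral and all moments $\int_\Omega x^hy^kW\,dx\,dy$ finite (defined up to null sets). It is $xy$-symmetric if $(x,y)\in\Omega$ implies $(-x,y),(x,-y)\in\Omega$, and $W(-x,y)=W(x,y)=W(x,-y)$ on $\Omega$. Polynomial systems: a sequence $\{\mathbb{P}_n\}_{n\geqslant0}$ of column vectors $\mathbb{P}_n=[P_{n,0},\dots,P_{n,n}]^\top$ of real bivariate polynomials, where the $n+1$ entries of $\mathbb{P}_n$ have total degree exactly $n$ and $\{P_{n,m}\}$ is a basis of the space of bivariate polynomials. It is monic if $P_{n,j}(x,y)=x^{n-j}y^j+(\text{polynomial of total degree}\leqslant n-1)$. The monic orthogonal polynomial system (MOPS) associated with $W$ on $\Omega$ is the unique monic system with $\int_\Omega \mathbb{P}_n\mathbb{P}_m^\top W\,dx\,dy=0$ for $n\ne m$ and equal to a symmetric positive-definite matrix for $n=m$. Big vector polynomials: for $W$ $xy$-symmetric with MOPS $\mathbb{S}_n=[S_{n,0},\dots,S_{n,n}]^\top$, each $S_{n,k}$ contains only powers of $x$ of the parity of $n-k$ and only powers of $y$ of the parity of $k$. In the displayed decomposition, indexing entries from $0$: $\mathbb{P}_n^{(0,0)}(x^2,y^2)$ (size $2n+1$) has entries $S_{2n,k}$ for $k$ even and $0$ for $k$ odd; $xy\,\mathbb{P}_{n-1}^{(1,1)}(x^2,y^2)$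 (size $2n+1$) has entries $S_{2n,k}$ for $k$ odd and $0$ for $k$ even; $x\,\mathbb{P}_n^{(1,0)}(x^2,y^2)$ (size $2n+2$) has entries $S_{2n+1,k}$ for $k$ even and $0$ for $k$ odd; $y\,\mathbb{P}_n^{(0,1)}(x^2,y^2)$ (size $2n+2$) has entries $S_{2n+1,k}$ for $k$ odd and $0$ for $k$ even. $\mathbb{P}_{-1}^{(1,1)}=0$. $\mathrm{J}_n^{(i,j)}$, $i,j\in\{0,1\}$, is the $(n+1)\times(2n+1+i+j)$ matrix whose entry (rows and columns indexed from $0$) in position $(h,2h+j)$ is $1$ for $0\leqslant h\leqslant n$, all other entries being $0$. *)

(* Defs.v *)
From HB Require Import structures.
From mathcomp Require Import all_boot all_order all_algebra.
From mathcomp Require Import all_classical all_reals all_analysis.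
(* The notations of [mpoly] clash with those of MathComp-Analysis. *)
From mathcomp Require Import -(notations) mpoly.

Set Implicit Arguments.
Unset Strict Implicit.
Unset Printing Implicit Defensive.

Import Order.TTheory GRing.Theory Num.Theory.
Import numFieldNormedType.Exports.

Local Open Scope classical_set_scope.
Local Open Scope ring_scope.

Notation bipoly R := (mpoly 2 R).

Section BivariatePolynomials.
Variable R : realType.
Local Notation bipoly := (bipoly R).

Definition polX : bipoly := mpolyX R (mnm1 (ord0 : 'I_2)).
Definition polY : bipoly := mpolyX R (mnm1 (ord_max : 'I_2)).

Definition peval (p : bipoly) (z : R * R) : R :=
  meval (fun i : 'I_2 => if i == ord0 then z.1 else z.2) p.

(* One plus the total degree of [p]; 0 if [p = 0]. *)
Definition total_size (p : bipoly) : nat := mmeasure mdeg p.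

(* p(x^2, y^2) *)
Definition psubst_sq (p : bipoly) : bipoly :=
  comp_mpoly [tuple polX ^+ 2; polY ^+ 2] p.

Definition poly_family := forall n : nat, 'cV[bipoly]_n.+1.

Definition lincomb (P : poly_family) (N : nat) (c : nat -> nat -> R) : bipoly :=
  \sum_(n < N) \sum_(m < n.+1) c n m *: P n m 0.

Definition is_basis (P : poly_family) : Prop :=
  (forall N c, lincomb P N c = 0 ->
     forall n m : nat, (m <= n < N)%N -> c n m = 0) /\
  (forall p : bipoly, exists N c, p = lincomb P N c).

Definition polynomial_system (P : poly_family) : Prop :=
  (forall n (m : 'I_n.+1), total_size (P n m 0) = n.+1) /\ is_basis P.

Definition monic_system (P : poly_family) : Prop :=
  polynomial_system P /\
  forall n (j : 'I_n.+1),
    (total_size (P n j 0 - polX ^+ (n - j) * polY ^+ j)%R <= n)%N.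

End BivariatePolynomials.

Notation leb2 R :=
  ((@lebesgue_measure R) \x (@lebesgue_measure R))%E (only parsing).

Section Weights.
Variable R : realType.
Implicit Types (Omega : set (R * R)) (W : R * R -> R).

Local Notation mu := (leb2 R).

(* The moment for [h = k = 0] makes [W] measurable on [Omega]; values of [W]
   outside [Omega] are irrelevant. *)
Definition weight_function Omega W : Prop :=
  [/\ measurable (Omega : set (measurableTypeR R * measurableTypeR R)),
      forall z, Omega z -> 0 <= W z,
      0 < \int[mu]_(z in Omega) W z &
      forall h k : nat,
        mu.-integrable Omega (EFin \o (fun z => z.1 ^+ h * z.2 ^+ k * W z))].

Definition xy_symmetric Omega W : Prop :=
  forall x y, Omega (x, y) ->
    [/\ Omega (- x, y), Omega (x, - y),
        W (- x, y) = W (x, y) & W (x, - y) = W (x, y)].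

Definition posdefmx n (H : 'M[R]_n) : Prop :=
  forall v : 'cV[R]_n, v != 0 -> 0 < (v^T *m H *m v) 0 0.

(* \int_Omega P_n P_m^T W *)
Definition gram Omega W (P : poly_family R) (n m : nat) : 'M[R]_(n.+1, m.+1) :=
  \matrix_(i, j) \int[mu]_(z in Omega)
    (peval (P n i 0) z * peval (P m j 0) z * W z).

Definition mops Omega W (P : poly_family R) : Prop :=
  [/\ monic_system P,
      forall n m, n <> m -> gram Omega W P n m = 0 &
      forall n, (gram Omega W P n n)^T = gram Omega W P n n /\
                posdefmx (gram Omega W P n n)].

End Weights.

Section BigVectors.
Variable R : realType.

(* [P i j n] is the big vector polynomial P_n^{(i,j)}, of size 2n+1+i+j; the
   size is written so that the sizes in the defining identities agree by
   conversion. *)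
Definition bigvecs :=
  forall (i j : bool) (n : nat), 'cV[bipoly R]_(i + j + n.*2.+1)%N.

(* The first identity is the case n = 0 of the even one, where
   P_{-1}^{(1,1)} = 0. *)
Definition big_vector_polynomials (S : poly_family R) (P : bigvecs) : Prop :=
  [/\ S 0%N = map_mx (@psubst_sq R) (P false false 0%N),
      forall n, S n.+1.*2 =
        map_mx (@psubst_sq R) (P false false n.+1) +
        (polX R * polY R) *: map_mx (@psubst_sq R) (P true true n) &
      forall n, S n.*2.+1 =
        polX R *: map_mx (@psubst_sq R) (P true false n) +
        polY R *: map_mx (@psubst_sq R) (P false true n)].

Definition Jmx (i j : bool) (n : nat) :
    'M[bipoly R]_(n.+1, (i + j + n.*2.+1)%N) :=
  \matrix_(h, l) ((l == h.*2 + j :> nat)%N)%:R.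

Definition hatP (P : bigvecs) (i j : bool) : poly_family R :=
  fun n => Jmx i j n *m P i j n.

Definition Omega_star (Omega : set (R * R)) : set (R * R) :=
  [set z | [/\ 0 <= z.1, 0 <= z.2 & Omega (Num.sqrt z.1, Num.sqrt z.2)]].

(* On the axes, a Lebesgue-null set, a quotient by 0 takes the value 0. *)
Definition Wij (W : R * R -> R) (i j : bool) (z : R * R) : R :=
  let x := z.1 in let y := z.2 in
  4^-1 * (match i, j with
          | false, false => 1 / Num.sqrt (x * y)
          | true,  false => Num.sqrt (x / y)
          | false, true  => Num.sqrt (y / x)
          | true,  true  => Num.sqrt (x * y)
          end) * W (Num.sqrt x, Num.sqrt y).

End BigVectors.

(* Main.v *)
(* Put L p = \int_Omega p W, and let L* be the analogous form of W^(i,j) on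
   Omega^*. The substitution (x, y) = (u^2, v^2), together with the symmetry of
   W, which folds the plane onto the quadrant, gives
   L* p = 1/4 L ((x^i y^j)^2 p(x^2, y^2)). The entry of index k = 2h+j of
   S_(2n+i+j) is x^i y^j A(x^2, y^2) + x^(1-i) y^(1-j) B(x^2, y^2), where A is the
   entry h of hatP_n. Comparing coefficients, A is monic with leading term
   x^(n-h) y^h. If r has degree < n, then x^i y^j r(x^2, y^2) has degree
   < 2n+i+j, so L (S_(2n+i+j,k) x^i y^j r(x^2, y^2)) = 0; the B-part contributes
   the integral of an odd function, which vanishes, hence L* (A r) = 0.
   Positivity on Omega^* comes from that of L (f f) for all f <> 0, itself a
   consequence of the positive definiteness of the Gram matrices of S. *)
Require Import Defs.
From HB Require Import structures.
From mathcomp Require Import all_boot all_order all_algebra.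
From mathcomp Require Import all_classical all_reals all_analysis.
From mathcomp Require Import -(notations) mpoly.
From mathcomp Require Import measurable_realfun ring.

Set Implicit Arguments.
Unset Strict Implicit.
Unset Printing Implicit Defensive.

Import Order.TTheory GRing.Theory Num.Theory.
Import numFieldNormedType.Exports.

Local Open Scope classical_set_scope.
Local Open Scope ring_scope.

(** * Substitution by squares in Lebesgue integrals *)

Section SquareSubstitution.
Context {R : realType}.
Local Notation lam := (@lebesgue_measure R).
Local Notation RT := (measurableTypeR R).
Local Open Scope ereal_scope.
Implicit Types f : R -> \bar R.

Lemma measurable_sqrtr : measurable_fun setT (@Num.sqrt R : RT -> RT).
Proof. by apply: continuous_measurable_fun; exact: sqrt_continuous. Qed.

Lemma measurable_inv_sqrtr :
  measurable_fun setT ((fun x => (Num.sqrt x)^-1%R) : RT -> RT).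
Proof.
have -> : (fun x : RT => (Num.sqrt x)^-1%R : RT) =
    (fun x => powR x (-1)) \o Num.sqrt.
  by apply/funext => x /=; rewrite powR_inv1// sqrtr_ge0.
by apply: measurableT_comp; [exact: measurable_powR|exact: measurable_sqrtr].
Qed.

(** By the fundamental theorem of calculus, [2u] being the derivative of [u^2]. It gives the mass
    that the density [2u] puts on an interval. *)
Lemma integral_itv_linear (a b : R) : (a <= b)%R ->
  \int[lam]_(x in `]a, b]) (x *+ 2)%:E = (b ^+ 2 - a ^+ 2)%:E.
Proof.
rewrite le_eqVlt => /predU1P[<-|ab].
  by rewrite set_itvoc0 integral_set0 subrr.
rewrite integral_itv_obnd_cbnd; last first.
  by apply/measurable_EFinP/measurable_funTS/measurable_funD.
rewrite (@continuous_FTC2 _ _ (fun x : R => (x ^+ 2)%R))//.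
- by apply: continuous_subspaceT => x; apply: cvgD; exact: cvg_id.
- split=> [x _| |]; first exact: exprn_derivable.
  + by apply: cvg_at_right_filter; exact: exprn_continuous.
  + by apply: cvg_at_left_filter; exact: exprn_continuous.
- by move=> x _; rewrite derive1E exp_derive /GRing.scale /= mulr1 expr1 mulr_natl.
Qed.

Let E : set (RT * RT) := [set z | (0 <= z.2)%R /\ (z.2 < z.1 *+ 2)%R].

Let measurable_E : measurable E.
Proof.
rewrite (_ : E = (fun z => (0 <= z.2)%R && (z.2 < z.1 *+ 2)%R) @^-1` [set true]);
  last by apply/seteqP; split => z /= => [[-> ->]|/andP[]].
rewrite -[X in measurable X]setTI; apply: (_ : measurable_fun setT _) => //.
apply: measurable_and; first exact: measurable_fun_ler.
by apply: measurable_fun_ltr => //; exact: measurable_funD.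
Qed.

(* Points outside [E] are sent to a junk point of the negative half-line, so
   that on ]0, +oo[ the image of the plane measure has density
   |{t | 0 <= t < 2u}| = 2u with respect to the image of du. *)
Let phi : RT * RT -> RT := fun z => if z \in E then (z.1 ^+ 2)%R else (-1)%R.

Let measurable_phi : measurable_fun setT phi.
Proof.
apply: measurable_fun_ifT => //.
  apply: (measurable_fun_bool true); rewrite [X in measurable X](_ : _ = E)//.
  by apply/seteqP; split=> z; [case=> _ /set_mem|split=> //; exact: mem_set].
exact: measurable_funX.
Qed.

Let nu : {measure set RT -> \bar R} :=
  measure_function_pushforward__canonical__measure_function_Measure
    (lam \x lam) measurable_phi.

(** By Tonelli, with [t] integrated first: at fixed [u] the integrand is the constant [f (u^2)] on a
    slice of length [2u]. *)
Let integral_nu f : measurable_fun setT f -> (forall x, 0 <= f x) ->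
  \int[nu]_(x in `]0%R, +oo[) f x =
  \int[lam]_(u in `]0%R, +oo[) (f (u ^+ 2)%R * (u *+ 2)%:E).
Proof.
move=> mf f0.
rewrite [LHS]ge0_integral_pushforward//=; last exact: measurable_funTS.
(* The junk value is negative, and [0 <= t < 2u] forces [u > 0], hence [u^2 > 0]. *)
have -> : phi @^-1` `]0%R, +oo[ = E.
  apply/seteqP; split => [[u t]|[u t] Eut]; rewrite /= in_itv/= andbT /phi.
    by case: ifPn => [/set_mem//|_]; rewrite ltr0N1.
  rewrite mem_set//= exprn_gt0//; move: Eut => [/= t0 tu].
  by rewrite -(@pmulrn_lgt0 _ u 2)// (le_lt_trans t0).
rewrite integral_mkcond fubini_tonelli1//=; last 2 first.
- apply: (measurable_restrictT _ measurable_E).1; apply: measurable_funTS.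
  exact: (measurableT_comp mf measurable_phi).
- by apply: erestrict_ge0 => z _ /=.
rewrite [RHS]integral_mkcond; apply: eq_integral => u _.
transitivity (\int[lam]_(t in `[0%R, (u *+ 2)%R[) cst (f (u ^+ 2)%R) t).
  rewrite [RHS]integral_mkcond; apply: eq_integral => t _.
  rewrite !patchE /= mem_setE in_itv/=.
  case: ifPn => [tE|/negP tE].
    by rewrite /phi tE; move/set_mem: tE => [/= -> ->].
  case: ifPn => // /andP[t0 tu]; exfalso; apply: tE.
  exact: mem_set.
rewrite integral_cst//= lebesgue_measure_itv/= lte_fin.
rewrite patchE mem_setE in_itv/= andbT pmulrn_lgt0//.
by case: ifPn => _; rewrite ?mule0// -EFinD subr0.
Qed.

(** Lebesgue measure is determined by its values on the intervals []a, b]]; for those, [nu] yields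
    the integral of [2u] between two square roots. *)
Let lam_nu (A : set RT) : measurable A -> (A : set R) `<=` `]0%R, +oo[ ->
  lam A = nu A.
Proof.
move=> mA A0.
have mD : measurable (`]0%R, +oo[ : set RT) by [].
(* Uniqueness concerns measures on the whole line, whereas [nu] is under control only on []0, +oo[];
   on the complement Lebesgue measure itself is glued in. *)
pose m : {measure set RT -> \bar R} :=
  measure_add (mrestr nu mD) (mrestr lam (measurableC mD)).
have mE B : m B = nu (B `&` `]0%R, +oo[) + lam (B `&` ~` `]0%R, +oo[).
  exact: measure_addE.
have -> : nu A = m A.
  rewrite mE (_ : A `&` _ = A); last exact/setIidl.
  rewrite (_ : A `&` ~` _ = set0) ?measure0 ?adde0//.
  by apply/seteqP; split => // x [Ax]; apply; exact: A0.
apply: lebesgue_measure_unique mA => X ocX.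
have mX : measurable (X : set RT) by exact: sub_sigma_algebra.
rewrite mE.
have -> : lam X = lam (X `&` `]0%R, +oo[) + lam (X `&` ~` `]0%R, +oo[).
  rewrite -measureU//=; last 3 first.
  - exact: measurableI.
  - by apply: measurableI => //; exact: measurableC.
  - by rewrite setIACA setICr !setI0.
  by rewrite -setIUr setUCr setIT.
congr (_ + _); move: ocX => [[a b] _ <-] /=.
have -> : nu (`]a, b] `&` `]0%R, +oo[) =
    \int[nu]_(x in `]0%R, +oo[) (\1_(`]a, b] : set RT) x)%:E.
  by rewrite integral_indic.
rewrite integral_nu//; last first.
  exact/measurable_EFinP/measurable_indic.
have aE : `]a, b]%classic `&` `]0%R, +oo[%classic =
    `]Num.max a 0%R, b]%classic :> set R.
  apply/seteqP; split => x /=; rewrite !in_itv/= andbT gt_max.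
    by move=> [/andP[-> ->] ->].
  by move=> /andP[/andP[-> ->] ->].
rewrite aE; set c := Num.max a 0%R.
have c0 : (0 <= c)%R by rewrite le_max lexx orbT.
rewrite lebesgue_measure_itv/= lte_fin.
transitivity (\int[lam]_(x in `]Num.sqrt c, Num.sqrt b]) (x *+ 2)%:E).
  case: ltP => cb.
    rewrite integral_itv_linear ?ler_wsqrtr ?(ltW cb)//.
    by rewrite !sqr_sqrtr// (le_trans c0)// ltW.
  by rewrite set_itv_ge ?integral_set0// bnd_simp -leNgt ler_wsqrtr.
rewrite [RHS]integral_mkcond [LHS]integral_mkcond; apply: eq_integral => u _.
rewrite !patchE !mem_setE !in_itv/= andbT indicE mem_setE in_itv/=.
have [u0|u0] := ltP 0%R u; last first.
  by rewrite (ltNge _ u) (le_trans u0) ?sqrtr_ge0.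
have u20 : (0 < u ^+ 2)%R by rewrite exprn_gt0.
rewrite -{1}[u]gtr0_norm// -{1}sqrtr_sqr ltr_sqrt// gt_max u20 andbT.
have -> : (u <= Num.sqrt b)%R = (u ^+ 2 <= b)%R.
  have [b0|b0] := leP 0%R b.
    by rewrite -{1}[u]gtr0_norm// -{1}sqrtr_sqr ler_sqrt.
  (* For [b < 0] the root is 0 by default, and both inequalities fail because [u > 0]. *)
  rewrite ltr0_sqrtr//.
  rewrite [LHS]leNgt u0; apply/esym/negbTE; rewrite -ltNge.
  exact: lt_trans u20.
by case: ifPn => _; rewrite ?mul1e ?mul0e.
Qed.

Lemma ge0_integral_substitution_sqr f : measurable_fun setT f ->
  (forall x, 0 <= f x) ->
  \int[lam]_(x in `]0%R, +oo[) f x =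
  \int[lam]_(u in `]0%R, +oo[) (f (u ^+ 2)%R * (u *+ 2)%:E).
Proof.
move=> mf f0; rewrite -integral_nu//.
by apply: eq_measure_integral => A mA A0; exact: lam_nu.
Qed.

End SquareSubstitution.

(** * Substitution by squares in the plane *)

Section PlaneSubstitution.
Context {R : realType}.
Local Notation lam := (@lebesgue_measure R).
Local Notation RT := (measurableTypeR R).
Local Notation mu := (leb2 R).
Local Open Scope ereal_scope.

(** With [x = u^2], the factor [1 / sqrt x] turns [2u du] into [2 du], and the 2 accounts for the
    two half-lines exchanged by [u -> -u]. Points [x <= 0] contribute nothing, since then
    [sqrt x = 0] and [0^-1 = 0]. *)
Lemma ge0_integral_sqrt_normr (f : R -> \bar R) : measurable_fun setT f ->
  (forall x, 0 <= f x) ->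
  \int[lam]_x (f (Num.sqrt x) * ((Num.sqrt x)^-1)%:E) = \int[lam]_u f `|u|%R.
Proof.
move=> mf f0.
have mfs : measurable_fun setT 
    (fun x : RT => f (Num.sqrt x) * ((Num.sqrt x)^-1)%:E).
  apply: emeasurable_funM; first exact: (measurableT_comp mf measurable_sqrtr).
  exact: (measurableT_comp (@EFin_measurable R setT) measurable_inv_sqrtr).
have mfn : measurable_fun setT (fun x : RT => f `|x|%R).
  exact: (measurableT_comp mf (@normr_measurable R setT)).
transitivity (\int[lam]_(x in `]0%R, +oo[)
    (f (Num.sqrt x) * ((Num.sqrt x)^-1)%:E)).
  rewrite [RHS]integral_mkcond; apply: eq_integral => x _.
  rewrite patchE mem_setE in_itv/= andbT; case: ltP => // x0.
  by rewrite ler0_sqrtr// invr0 mule0.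
rewrite ge0_integral_substitution_sqr//; last first.
  by move=> x; rewrite mule_ge0// lee_fin invr_ge0 sqrtr_ge0.
transitivity (\int[lam]_(u in `]0%R, +oo[) (f `|u|%R *+ 2)).
  apply: eq_integral => u; rewrite mem_setE in_itv/= andbT => u0.
  rewrite sqrtr_sqr -muleA -EFinM gtr0_norm// mulrnAr mulVf ?gt_eqF//.
  by rewrite muleC mule_natl.
transitivity (\int[lam]_(u in `]0%R, +oo[) (f `|u|%R) +
              \int[lam]_(u in `]0%R, +oo[) (f `|u|%R)).
  rewrite -ge0_integralD//; exact: measurable_funTS.
rewrite -[in RHS](setUv (`]0%R, +oo[%classic : set R)) ge0_integral_setU//=; last 3 first.
- exact: measurableC.
- by rewrite setUv.
- by apply/disj_setPS => x [].
congr (_ + _); rewrite setCitvr integral_itv_obnd_cbnd; last first.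
  exact: measurable_funTS.
rewrite ge0_integration_by_substitution0//.
by apply: eq_integral => x _; rewrite normrN.
Qed.

(** Tonelli reduces this to the one-variable formula, used first in [y], then in [x]. *)
Lemma ge0_integral2_sqrt_normr (g : RT * RT -> \bar R) :
  measurable_fun setT g -> (forall z, 0 <= g z) ->
  \int[mu]_z (g (Num.sqrt z.1, Num.sqrt z.2) *
              ((Num.sqrt z.1)^-1 * (Num.sqrt z.2)^-1)%:E) =
  \int[mu]_z g (`|z.1|%R, `|z.2|%R).
Proof.
move=> mg g0.
have m1 : measurable_fun setT (fst : RT * RT -> RT) by [].
have m2 : measurable_fun setT (snd : RT * RT -> RT) by [].
have mN := @normr_measurable R setT.
have mgs : measurable_fun setT (fun z : RT * RT => g (Num.sqrt z.1, Num.sqrt z.2)).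
  apply: (measurableT_comp mg); apply: measurable_fun_pair.
    exact: (measurableT_comp measurable_sqrtr m1).
  exact: (measurableT_comp measurable_sqrtr m2).
have mgn : measurable_fun setT (fun z : RT * RT => g (`|z.1|%R, `|z.2|%R)).
  apply: (measurableT_comp mg); apply: measurable_fun_pair.
    exact: (measurableT_comp mN m1).
  exact: (measurableT_comp mN m2).
have mgsn : measurable_fun setT (fun z : RT * RT => g (z.1, `|z.2|%R)).
  apply: (measurableT_comp mg); apply: measurable_fun_pair => //.
  exact: (measurableT_comp mN m2).
rewrite fubini_tonelli1//=; last 2 first.
- apply: (emeasurable_funM mgs); apply/measurable_EFinP.
  apply: measurable_funM; first exact: (measurableT_comp measurable_inv_sqrtr m1).
  exact: (measurableT_comp measurable_inv_sqrtr m2).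
- by move=> z; rewrite mule_ge0// lee_fin mulr_ge0// invr_ge0 sqrtr_ge0.
rewrite (fubini_tonelli1 _ mgn)//= /fubini_F/=.
transitivity (\int[lam]_x ((\int[lam]_y g (Num.sqrt x, `|y|%R)) *
                           ((Num.sqrt x)^-1)%:E)).
  apply: eq_integral => x _.
  have mgx : measurable_fun setT (fun y : RT => g (Num.sqrt x, y)).
    exact: measurable_fun_pair2.
  rewrite -(ge0_integral_sqrt_normr (f := fun y => g (Num.sqrt x, y)))//.
  rewrite -ge0_integralZr//; last 2 first.
  - apply: emeasurable_funM; first exact: (measurableT_comp mgx measurable_sqrtr).
    exact: (measurableT_comp (@EFin_measurable R setT) measurable_inv_sqrtr).
  - by move=> y _; rewrite mule_ge0// lee_fin invr_ge0 sqrtr_ge0.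
  by apply: eq_integral => y _; rewrite -muleA -EFinM mulrC.
rewrite (ge0_integral_sqrt_normr (f := fun x => \int[lam]_y g (x, `|y|%R)))//.
- exact: (measurable_fun_fubini_tonelli_F (m2 := lam) _ mgsn).
- by move=> x; apply: integral_ge0.
Qed.

End PlaneSubstitution.

(** * Integrals over domains symmetric in both axes *)

Section SymmetricDomain.
Context {R : realType}.
Local Notation lam := (@lebesgue_measure R).
Local Notation RT := (measurableTypeR R).
Local Notation mu := (leb2 R).
Implicit Types (Omega : set (RT * RT)) (h : R * R -> R).

Definition sqrt_pair (z : RT * RT) : RT * RT := (Num.sqrt z.1, Num.sqrt z.2).

(** On the open quadrant, four times the Jacobian of [sqrt_pair]; it is 0 as soon as one coordinate
    is nonpositive. *)
Definition inv_sqrt_pair (z : RT * RT) : R :=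
  (Num.sqrt z.1)^-1 * (Num.sqrt z.2)^-1.

Lemma inv_sqrt_pair_ge0 z : 0 <= inv_sqrt_pair z.
Proof. by rewrite mulr_ge0// invr_ge0 sqrtr_ge0. Qed.

Lemma measurable_sqrt_pair : measurable_fun setT sqrt_pair.
Proof.
apply: measurable_fun_pair.
  exact: (measurableT_comp measurable_sqrtr (@measurable_fst _ _ RT RT)).
exact: (measurableT_comp measurable_sqrtr (@measurable_snd _ _ RT RT)).
Qed.

Lemma measurable_inv_sqrt_pair : measurable_fun setT inv_sqrt_pair.
Proof.
apply: measurable_funM.
  exact: (measurableT_comp measurable_inv_sqrtr (@measurable_fst _ _ RT RT)).
exact: (measurableT_comp measurable_inv_sqrtr (@measurable_snd _ _ RT RT)).
Qed.

Lemma xy_symmetric_oppP Omega h : xy_symmetric Omega h ->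
  (forall x y, Omega (- x, y) <-> Omega (x, y)) /\
  (forall x y, Omega (x, - y) <-> Omega (x, y)).
Proof.
move=> sym; split=> x y.
  by split=> [/sym[+ _ _ _]|/sym[]//]; rewrite opprK.
by split=> [/sym[_ + _ _]|/sym[]//]; rewrite opprK.
Qed.

Lemma xy_symmetric_normP Omega h : xy_symmetric Omega h ->
  (forall x y, Omega (`|x|, `|y|) <-> Omega (x, y)) /\
  (forall x y, Omega (x, y) -> h (`|x|, `|y|) = h (x, y)).
Proof.
move=> sym.
have [Ox Oy] := xy_symmetric_oppP sym.
split=> x y.
  by case: ger0P => _; case: ger0P => _; rewrite ?Ox ?Oy.
move=> Oxy; have [_ _ hx hy] := sym _ _ Oxy.
case: ger0P => _; case: ger0P => _ //.
by have [|_ _ -> _] := sym x (- y); [exact/Oy|].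
Qed.

Lemma measurable_Omega_star Omega : measurable Omega ->
  measurable (Omega_star Omega : set (RT * RT)).
Proof.
move=> mO.
rewrite (_ : Omega_star Omega =
  (fst @^-1` `[0, +oo[) `&` (snd @^-1` `[0, +oo[) `&` (sqrt_pair @^-1` Omega)).
  apply: measurableI; first apply: measurableI.
  - by rewrite -[X in measurable X]setTI; exact: measurable_fst.
  - by rewrite -[X in measurable X]setTI; exact: measurable_snd.
  - by rewrite -[X in measurable X]setTI; exact: measurable_sqrt_pair.
apply/seteqP; split=> [z /= [z1 z2 Oz]|z /= [[z1 z2] Oz]].
  by split=> //; split; rewrite in_itv/= andbT.
by move: z1 z2; rewrite !in_itv/= !andbT.
Qed.

Section ge0.
Local Open Scope ereal_scope.
Variables (Omega : set (RT * RT)) (g : RT * RT -> \bar R).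
Hypotheses (mO : measurable Omega) (mg : measurable_fun Omega g).
Hypothesis (normO : forall x y, Omega (`|x|, `|y|)%R <-> Omega (x, y)).

(** The sign conditions in [Omega_star] are absorbed by the factor [inv_sqrt_pair], which vanishes
    at points with a negative coordinate. What remains is [g] extended by 0 outside [Omega]. *)
Let restr_star : (fun z => g (sqrt_pair z) * (inv_sqrt_pair z)%:E) \_ (Omega_star Omega) =
  (fun z => (g \_ Omega) (sqrt_pair z) * (inv_sqrt_pair z)%:E).
Proof.
apply/funext => z; rewrite !patchE.
case: ifPn => [/set_mem[z1 z2 Oz]|/negP Oz]; first by rewrite mem_set.
case: ifPn => [/set_mem Oz'|_]; last by rewrite mul0e.
have [z1|z1] := leP 0%R z.1; have [z2|z2] := leP 0%R z.2.
- by exfalso; apply: Oz; apply/mem_set; split.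
all: rewrite /inv_sqrt_pair ?(ltr0_sqrtr z1) ?(ltr0_sqrtr z2) ?invr0 ?mulr0 ?mul0r mule0//.
Qed.

Lemma measurable_fun_sqrt_pair :
  measurable_fun (Omega_star Omega) (fun z => g (sqrt_pair z) * (inv_sqrt_pair z)%:E).
Proof.
apply/(measurable_restrictT _ (measurable_Omega_star mO)); rewrite restr_star.
apply: emeasurable_funM.
  exact: (measurableT_comp ((measurable_restrictT _ mO).1 mg) measurable_sqrt_pair).
exact: (measurableT_comp (@EFin_measurable R setT) measurable_inv_sqrt_pair).
Qed.

Hypothesis g0 : forall z, Omega z -> 0 <= g z.
Hypothesis normg : forall x y, Omega (x, y) -> g (`|x|, `|y|)%R = g (x, y).

(** The plane substitution leaves [g] at absolute values, which symmetry identifies with [g]. No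
    factor 1/4 appears: the four quadrants compensate the Jacobian. *)
Lemma ge0_integral_sqrt_pair :
  \int[mu]_(z in Omega_star Omega) (g (sqrt_pair z) * (inv_sqrt_pair z)%:E) =
  \int[mu]_(z in Omega) g z.
Proof.
rewrite integral_mkcond restr_star [RHS]integral_mkcond.
rewrite [LHS]ge0_integral2_sqrt_normr; last 2 first.
- exact/(measurable_restrictT _ mO).
- exact: erestrict_ge0.
apply: eq_integral => -[x y] _ /=; rewrite !patchE.
case: ifPn => [/set_mem/normO Oxy|/negP Oxy]; first by rewrite mem_set// normg.
rewrite memNset// => /normO Oxy'; apply: Oxy; exact: mem_set.
Qed.

End ge0.

(** The nonnegative formula is applied to [|h|] for integrability, and to the positive and negative
    parts of [h] for the value; both parts commute with multiplication by the nonnegative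
    [inv_sqrt_pair]. *)
Lemma integrable_sqrt_pair Omega h : measurable Omega -> xy_symmetric Omega h ->
  mu.-integrable Omega (EFin \o h) ->
  mu.-integrable (Omega_star Omega)
    (EFin \o (fun z => h (sqrt_pair z) * inv_sqrt_pair z)) /\
  \int[mu]_(z in Omega_star Omega) (h (sqrt_pair z) * inv_sqrt_pair z) =
  \int[mu]_(z in Omega) h z.
Proof.
move=> mO /xy_symmetric_normP[normO normh] ih.
have /integrableP[mh hoo] := ih.
pose k := inv_sqrt_pair.
have k0 z : 0 <= k z by exact: inv_sqrt_pair_ge0.
split.
  apply/integrableP; split; first exact: (measurable_fun_sqrt_pair mO mh).
  rewrite (eq_integral (fun z => (abse \o (EFin \o h)) (sqrt_pair z) * (k z)%:E)%E).
    rewrite ge0_integral_sqrt_pair//.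
    - exact: measurableT_comp.
    - by move=> z _ /=; rewrite lee_fin.
    - by move=> x y Oxy /=; rewrite normh.
  by move=> z _ /=; rewrite normrM (ger0_norm (k0 z)) EFinM.
rewrite /Rintegral integralE [in RHS]integralE; congr (fine (_ - _)%E).
- rewrite -(ge0_integral_sqrt_pair mO _ normO)//; last 2 first.
  + exact: measurable_funepos.
  + by move=> x y Oxy; rewrite !funeposE /= normh.
  apply: eq_integral => z _; rewrite !funeposE /= -!EFin_max -EFinM.
  by rewrite maxr_pMl// mul0r.
- rewrite -(ge0_integral_sqrt_pair mO _ normO)//; last 2 first.
  + exact: measurable_funeneg.
  + by move=> x y Oxy; rewrite !funenegE /= normh.
  apply: eq_integral => z _; rewrite !funenegE /= -!EFin_max -EFinM.
  by rewrite maxr_pMl// mul0r mulNr.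
Qed.

(** * Vanishing of integrals of odd functions *)

Section Reflection.
Variables (s t : RT -> RT).
Hypotheses (ms : measurable_fun setT s) (mt : measurable_fun setT t).
Hypothesis lam_s : forall A : set RT, measurable A -> lam (s @^-1` A) = lam A.
Hypothesis lam_t : forall A : set RT, measurable A -> lam (t @^-1` A) = lam A.

Let st (z : RT * RT) : RT * RT := (s z.1, t z.2).

Let measurable_st : measurable_fun setT st.
Proof.
apply: measurable_fun_pair.
  exact: (measurableT_comp ms (@measurable_fst _ _ RT RT)).
exact: (measurableT_comp mt (@measurable_snd _ _ RT RT)).
Qed.

(** The map [st] preserves plane measure, so the integral equals its own opposite. *)
Lemma Rintegral_odd Omega h : measurable Omega ->
  (forall z, Omega (st z) <-> Omega z) ->
  (forall z, Omega z -> h (st z) = - h z) ->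
  mu.-integrable Omega (EFin \o h) ->
  \int[mu]_(z in Omega) h z = 0.
Proof.
move=> mO stO hst ih.
pose hO := h \_ Omega.
have hOst z : hO (st z) = - hO z.
  rewrite /hO !patchE; case: ifPn => [/set_mem/stO Oz|/negP Oz].
    by rewrite mem_set// hst.
  rewrite memNset ?oppr0// => /stO Oz'; apply: Oz; exact: mem_set.
have ihO : mu.-integrable setT (EFin \o hO).
  by rewrite /hO -restrict_EFin; apply/integrable_restrict; rewrite ?setTI.
rewrite Rintegral_mkcond -/hO.
suff e : \int[mu]_z hO z = - \int[mu]_z hO z.
  by move/eqP: e; rewrite -addr_eq0 -mulr2n mulrn_eq0 => /eqP.
rewrite -mulN1r -RintegralZl//.
transitivity (\int[mu]_z hO (st z)); last first.
  by apply: eq_Rintegral => z _; rewrite hOst mulN1r.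
have /integrableP[mhO _] := ihO.
rewrite /Rintegral; congr fine.
have ihOst : mu.-integrable (st @^-1` setT) ((EFin \o hO) \o st).
  rewrite preimage_setT.
  rewrite (_ : _ \o _ = (fun z => (-1)%:E * (EFin \o hO) z)%E).
    exact: integrableZl.
  by apply/funext => z /=; rewrite hOst -EFinM mulN1r.
have := integral_pushforward measurable_st mhO ihOst measurableT.
rewrite preimage_setT => <-.
apply: eq_measure_integral => A mA _.
(* Invariance of plane measure need only be checked on rectangles, where it splits into [lam_s] and
   [lam_t]. *)
apply: product_measure_unique => // B C mB mC /=.
rewrite -[LHS]/((lam \x lam)%E ((s @^-1` B) `*` (t @^-1` C))).
have mst : measurable (s @^-1` B) by rewrite -[X in measurable X]setTI; exact: ms.
have mtt : measurable (t @^-1` C) by rewrite -[X in measurable X]setTI; exact: mt.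
by rewrite product_measure1E//= lam_s// lam_t.
Qed.

End Reflection.

End SymmetricDomain.

(** * Coefficients and monic systems *)


Local Open Scope classical_set_scope.
Local Open Scope ring_scope.

Section BivariateCoefficients.
Variable R : realType.
Implicit Types (p q : bipoly R) (P : poly_family R).

Definition bimon (a b : nat) : multinom 2 :=
  mnm_add (mnm_muln (mnm1 ord0) a) (mnm_muln (mnm1 ord_max) b).

Local Notation coef a b := (mcoeff (bimon a b)).

Lemma bimon0E a b : bimon a b ord0 = a.
Proof. by rewrite mnmDE !mulmnE !mnm1E eqxx mul1n mul0n addn0. Qed.

Lemma bimon1E a b : bimon a b ord_max = b.
Proof. by rewrite mnmDE !mulmnE !mnm1E eqxx mul1n mul0n. Qed.

Lemma bimon_eqE a b c d : (bimon a b == bimon c d) = (a == c) && (b == d).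
Proof.
apply/eqP/andP => [e|[/eqP-> /eqP->]//].
have := congr1 (fun m : multinom 2 => (m ord0, m ord_max)) e.
by rewrite /= !bimon0E !bimon1E => -[-> ->].
Qed.

Lemma bimonE (m : multinom 2) : m = bimon (m ord0) (m ord_max).
Proof.
apply/mnmP => i; have /orP[/eqP->|/eqP->] : (i == ord0) || (i == ord_max).
- by case: i => -[|[]].
- by rewrite bimon0E.
- by rewrite bimon1E.
Qed.

Lemma mdeg_bimon a b : mdeg (bimon a b) = (a + b)%N.
Proof. by rewrite mdegD !mdegMn !mdeg1 !mul1n. Qed.

Lemma polXY_bimon a b : polX R ^+ a * polY R ^+ b = mpolyX R (bimon a b).
Proof. by rewrite /polX /polY !mpolyXn mpolyXD. Qed.

Lemma coef_polXY a b c d :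
  coef c d (polX R ^+ a * polY R ^+ b) = ((a == c) && (b == d))%:R.
Proof. by rewrite polXY_bimon mcoeffX bimon_eqE. Qed.

Lemma coef_eqP p q : (forall a b, coef a b p = coef a b q) -> p = q.
Proof. by move=> pq; apply/mpolyP => m; rewrite (bimonE m). Qed.

Lemma total_size_leP p N :
  reflect (forall a b, (N <= a + b)%N -> coef a b p = 0) (total_size p <= N)%N.
Proof.
apply: (iffP idP) => [pN a b Nab|p0].
  apply/eqP; rewrite mcoeff_eq0; apply: msize_mdeg_ge.
  by rewrite mdeg_bimon (leq_trans pN).
rewrite /total_size mmeasureE; apply/bigmax_leqP_seq => m mp _.
rewrite ltnNge; apply/negP => Nm; move: mp.
rewrite mcoeff_msupp (bimonE m) p0 ?eqxx//.
by rewrite -mdeg_bimon -bimonE.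
Qed.

Lemma polXY_psubst_sqE i j p : polX R ^+ i * polY R ^+ j * psubst_sq p =
  \sum_(m <- msupp p)
    mcoeff m p *: (polX R ^+ ((m ord0).*2 + i) * polY R ^+ ((m ord_max).*2 + j)).
Proof.
rewrite /psubst_sq comp_mpolyE mulr_sumr; apply: eq_bigr => m _.
rewrite -scalerAr big_ord_recl big_ord1 /= -2!exprM !mul2n !exprD.
congr (_ *: _); rewrite (_ : lift ord0 ord0 = ord_max); last exact/val_inj.
by rewrite mulrACA [polX R ^+ i * _]mulrC [polY R ^+ j * _]mulrC.
Qed.

Lemma double_add_bool_eq (m n : nat) (i j : bool) :
  (m.*2 + i == n.*2 + j)%N = (m == n) && (i == j).
Proof.
apply/eqP/andP => [e|[/eqP-> /eqP->]//].
have ij : i = j by have := congr1 odd e; rewrite !oddD !odd_double !oddb.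
split; last exact/eqP.
by move: e; rewrite ij => /addIn /double_inj ->.
Qed.

(** Every exponent is uniquely [2a + k] with a parity bit [k], so this describes all coefficients:
    they vanish unless the parities are [(i, j)]. *)
Lemma coef_polXY_psubst_sq (i j k l : bool) p a b :
  coef (a.*2 + k) (b.*2 + l) (polX R ^+ i * polY R ^+ j * psubst_sq p) =
  if (i == k) && (j == l) then coef a b p else 0.
Proof.
rewrite polXY_psubst_sqE raddf_sum /=.
have E (m : multinom 2) :
    coef (a.*2 + k) (b.*2 + l) (mcoeff m p *: (polX R ^+ ((m ord0).*2 + i) *
      polY R ^+ ((m ord_max).*2 + j))) =
    if (i == k) && (j == l) then mcoeff m p * (m == bimon a b)%:R else 0.
  rewrite mcoeffZ coef_polXY !double_add_bool_eq.
  have -> : (m == bimon a b) = (m ord0 == a) && (m ord_max == b).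
    by rewrite {1}(bimonE m) bimon_eqE.
  by case: (i == k) (j == l) => -[]; rewrite ?andbT ?andbF ?mulr0.
under eq_bigr do rewrite E.
case: ifP => _; last by rewrite big1.
rewrite [in RHS](mpolyE p) raddf_sum /=; apply: eq_bigr => m _.
by rewrite mcoeffZ mcoeffX.
Qed.

Lemma peval_psubst_sq p z : peval (psubst_sq p) z = peval p (z.1 ^+ 2, z.2 ^+ 2).
Proof.
rewrite /peval /psubst_sq comp_mpoly_meval; apply: meval_eq => i /=.
have /orP[/eqP->|/eqP->] : (i == ord0) || (i == ord_max).
- by case: i => -[|[]].
- by rewrite rmorphXn /= mevalXU.
- by rewrite rmorphXn /= mevalXU.
Qed.

Lemma pevalD p q z : peval (p + q) z = peval p z + peval q z.
Proof. exact: mevalD. Qed.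

Lemma pevalM p q z : peval (p * q) z = peval p z * peval q z.
Proof. exact: mevalM. Qed.

Lemma pevalZ c p z : peval (c *: p) z = c * peval p z.
Proof. exact: mevalZ. Qed.

Lemma peval_polXY a b z : peval (polX R ^+ a * polY R ^+ b) z = z.1 ^+ a * z.2 ^+ b.
Proof. by rewrite pevalM /peval !rmorphXn /= !mevalXU. Qed.

Lemma pevalE p z :
  peval p z = \sum_(m <- msupp p) mcoeff m p * (z.1 ^+ m ord0 * z.2 ^+ m ord_max).
Proof.
rewrite {1}(mpolyE p) /peval raddf_sum; apply: eq_bigr => m _.
by rewrite /= mevalZ {2}(bimonE m) -polXY_bimon -peval_polXY.
Qed.

Definition bimonic (p : bipoly R) (n j : nat) : Prop :=
  forall a b, (n <= a + b)%N -> coef a b p = ((n - j == a)%N && (j == b))%:R.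

Lemma bimonicP p n j :
  (total_size (p - polX R ^+ (n - j) * polY R ^+ j)%R <= n)%N <-> bimonic p n j.
Proof.
split=> [/total_size_leP h a b ab|h].
  by apply/eqP; rewrite -subr_eq0 -coef_polXY -mcoeffB h.
apply/total_size_leP => a b ab.
by rewrite mcoeffB coef_polXY h// subrr.
Qed.

(** * Families with prescribed leading terms are bases *)

Section Monic.
Variable P : poly_family R.
Hypothesis monicP : forall n (j : 'I_n.+1), bimonic (P n j 0) n j.

Lemma monic_total_size n (j : 'I_n.+1) : total_size (P n j 0) = n.+1.
Proof.
have jn : (n - j + j)%N = n by rewrite subnK// -ltnS.
apply/eqP; rewrite eqn_leq; apply/andP; split.
  apply/total_size_leP => a b ab; rewrite monicP ?(ltnW ab)//.
  case: eqP => //= e; case: eqP => //= e2.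
  by move: ab; rewrite -e -e2 jn ltnn.
rewrite ltnNge; apply/negP => /total_size_leP/(_ (n - j)%N j).
rewrite jn => /(_ (leqnn _)) /eqP.
by rewrite monicP ?jn// !eqxx /= oner_eq0.
Qed.

(** The leading terms in row [n] are distinct monomials, told apart by their exponent in [y], so
    each coordinate can be read off as one coefficient. *)
Lemma coef_top_comb n (v : 'I_n.+1 -> R) (a b : nat) : (a + b = n)%N ->
  coef a b (\sum_m v m *: P n m 0) = v (inord b).
Proof.
move=> ab; have bn : (b < n.+1)%N by rewrite -ab ltnS leq_addl.
have nb : (n - b)%N = a by rewrite -ab addnK.
rewrite raddf_sum (bigD1 (inord b)) //= big1 ?addr0 => [|m mb].
  by rewrite mcoeffZ monicP ?ab// inordK// nb !eqxx mulr1.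
rewrite mcoeffZ monicP ?ab// (_ : (m == b :> nat) = false) ?andbF ?mulr0//.
by apply: contraNF mb => /eqP mb; rewrite -mb inord_val.
Qed.

Lemma total_size_top_comb n (v : 'I_n.+1 -> R) :
  (total_size (\sum_m v m *: P n m 0)%R <= n.+1)%N.
Proof.
apply/total_size_leP => a b ab; rewrite raddf_sum big1// => m _.
rewrite /= mcoeffZ; move: (@monic_total_size n m) => /eq_leq/total_size_leP ->//.
by rewrite mulr0.
Qed.

(** The subtracted combination has the same homogeneous part of degree [N] as [p]. This is the
    induction step for spanning. *)
Lemma total_size_reduce p N : (total_size p <= N.+1)%N ->
  (total_size (p - \sum_(m < N.+1) coef (N - m) m p *: P N m 0)%R <= N)%N.
Proof.
move=> /total_size_leP pN; apply/total_size_leP => a b.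
rewrite leq_eqVlt => /predU1P[/esym ab|ab]; rewrite mcoeffB.
  rewrite coef_top_comb// inordK; last by rewrite -ab ltnS leq_addl.
  by rewrite (_ : (N - b)%N = a) ?subrr// -ab addnK.
by rewrite pN// (total_size_leP _ _ (total_size_top_comb _))// subr0.
Qed.

Lemma lincombS N c : lincomb P N.+1 c = 
  lincomb P N c + \sum_(m < N.+1) c N m *: P N m 0.
Proof. by rewrite /lincomb big_ord_recr. Qed.

Lemma eq_lincomb N c d : (forall n m, (n < N)%N -> c n m = d n m) ->
  lincomb P N c = lincomb P N d.
Proof.
by move=> cd; apply: eq_bigr => n _; apply: eq_bigr => m _; rewrite cd.
Qed.

Lemma total_size_lincomb N c : (total_size (lincomb P N c) <= N)%N.
Proof.
apply/total_size_leP => a b ab; rewrite raddf_sum big1// => n _.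
apply: (total_size_leP _ _ (total_size_top_comb _)) => //.
exact: leq_trans ab.
Qed.

Lemma lincomb_span p N : (total_size p <= N)%N -> exists c, p = lincomb P N c.
Proof.
elim: N p => [|N IH] p pN.
  exists (fun _ _ => 0); rewrite /lincomb big_ord0.
  by apply/eqP; rewrite -msize_poly_eq0 -leqn0.
have [c cE] := IH _ (total_size_reduce pN).
exists (fun n m => if n == N then coef (N - m) m p else c n m).
rewrite lincombS eqxx -(@eq_lincomb N c); last first.
  by move=> n m; rewrite ltn_neqAle => /andP[/negbTE->].
by rewrite -cE subrK.
Qed.

(** Triangularity: lower rows have no terms of degree [N], so the top row of [c] vanishes first,
    then the others by induction. *)
Lemma lincomb_free N c : lincomb P N c = 0 ->
  forall n m, (m <= n < N)%N -> c n m = 0.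
Proof.
elim: N => [|N IH]; first by move=> _ n m; rewrite ltn0 andbF.
rewrite lincombS => e.
have cN m : (m <= N)%N -> c N m = 0.
  move=> mN; have := congr1 (coef (N - m) m) e.
  rewrite mcoeffD mcoeff0 (total_size_leP _ _ (total_size_lincomb _ _)).
    by rewrite add0r (@coef_top_comb N (fun m => c N m)) ?subnK// inordK.
  by rewrite subnK.
move=> n m /andP[mn]; rewrite ltnS leq_eqVlt => /predU1P[nN|nN].
  by rewrite nN cN// -nN.
apply: IH; last by rewrite mn.
move: e; rewrite big1 ?addr0// => k _; rewrite cN ?scale0r//.
by rewrite -ltnS.
Qed.

Lemma monic_systemP : monic_system P.
Proof.
split; last by move=> n j; apply/bimonicP.
split; first exact: monic_total_size.
split; first exact: lincomb_free.
by move=> p; exists (total_size p); apply: lincomb_span.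
Qed.

End Monic.

Lemma monic_system_bimonic P : monic_system P ->
  forall n (j : 'I_n.+1), bimonic (P n j 0) n j.
Proof. by move=> [_ h] n j; apply/bimonicP. Qed.

End BivariateCoefficients.

(** * Big vector polynomials and orthogonality *)

Lemma addNb (b : bool) : (~~ b + b = 1)%N. Proof. by case: b. Qed.

Section BigVectorEntries.
Variable R : realType.
Implicit Types (p q r : bipoly R) (S : poly_family R) (P : bigvecs R).
Local Notation coef a b := (mcoeff (bimon a b)).
Local Notation xy i j := (polX R ^+ i * polY R ^+ j).

Lemma psubst_sqM p q : psubst_sq (p * q) = psubst_sq p * psubst_sq q.
Proof. exact: rmorphM. Qed.

(* The defining identities do not say that the second summand vanishes, and it
   need not be known: its parity makes it orthogonal to everything that is
   tested against the first one. *)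
Lemma hatP_entry S P : big_vector_polynomials S P ->
  forall (i j : bool) n (h : 'I_n.+1),
  exists (k : 'I_(i + j + n.*2).+1) (q : bipoly R), k = (h.*2 + j)%N :> nat /\
    S (i + j + n.*2)%N k 0 =
      xy i j * psubst_sq (hatP P i j n h 0) + xy (~~ i) (~~ j) * psubst_sq q.
Proof.
move=> [S0 Seven Sodd] i j n h.
have hn : (h.*2 + j < i + j + n.*2.+1)%N.
  rewrite addnS ltnS (addnC i) -addnA [leqRHS]addnC leq_add2r.
  by rewrite (leq_trans _ (leq_addl _ _))// leq_double -ltnS.
have hatPE : hatP P i j n h 0 = P i j n (Ordinal hn) 0.
  rewrite !mxE (bigD1 (Ordinal hn)) //= big1 ?addr0; last first.
    move=> l lh; rewrite mxE (_ : (l == (h.*2 + j)%N :> nat) = false) ?mul0r//.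
    by apply: contraNF lh => /eqP lh; apply/eqP/val_inj.
  by rewrite mxE eqxx mul1r.
have hn' : (h.*2 + j < (i + j + n.*2).+1)%N by move: (hn); rewrite addnS.
exists (Ordinal hn').
rewrite hatPE; case: i j hn hn' {hatPE} => -[] hn hn'.
(* Here the degree is [2n + 2], so the even identity is used at [n.+1] with the roles of its two
   summands exchanged. *)
- exists (P false false n.+1 (Ordinal hn) 0); split=> //.
  rewrite [S _](Seven n) !mxE addrC !mul1r ?expr1 ?mulr1.
  by rewrite (bool_irrelevance hn' hn).
- exists (P false true n (Ordinal hn) 0); split=> //.
  rewrite [S _](Sodd n) !mxE !mul1r ?expr1 ?mulr1.
  by rewrite (bool_irrelevance hn' hn).
- exists (P true false n (Ordinal hn) 0); split=> //.
  rewrite [S _](Sodd n) !mxE addrC !mul1r ?expr1 ?mulr1.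
  by rewrite (bool_irrelevance hn' hn).
(* The complementary part has index [n - 1], so [n = 0] is separate: the witness 0 stands for the
   vanishing vector of index -1. *)
- case: n h hn hn' => [|n] h hn hn'.
    exists 0; split=> //.
    rewrite [S _]S0 !mxE !mul1r [X in _ * X]raddf0 mulr0 addr0.
    by rewrite (bool_irrelevance hn' hn).
  exists (P true true n (Ordinal hn) 0); split=> //.
  rewrite [S _](Seven n) !mxE !mul1r ?expr1 ?mulr1.
  by rewrite (bool_irrelevance hn' hn).
Qed.

(** The second summand only has exponents of the opposite parity in each variable. *)
Lemma coef_hatP_entry (i j : bool) p q a b :
  coef (a.*2 + i) (b.*2 + j)
    (xy i j * psubst_sq p + xy (~~ i) (~~ j) * psubst_sq q) = coef a b p.
Proof.
rewrite mcoeffD !coef_polXY_psubst_sq !eqxx /=.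
by case: i => /=; rewrite addr0.
Qed.

(** Coefficients of the entry are coefficients of [S] at the exponents [2a + i], [2b + j], whose sum
    reaches the degree [2n + i + j] once [a + b >= n]. *)
Lemma hatP_bimonic S P : monic_system S -> big_vector_polynomials S P ->
  forall (i j : bool) n (h : 'I_n.+1), bimonic (hatP P i j n h 0) n h.
Proof.
move=> /monic_system_bimonic monicS SP i j n h a b ab.
have [k [q [kE Sk]]] := hatP_entry SP i j h.
have hn : (h <= n)%N by rewrite -ltnS.
rewrite -(coef_hatP_entry i j _ q) -Sk monicS; last first.
  by rewrite addnACA [leqRHS]addnC leq_add2l -doubleD leq_double.
(* The leading term of the entry [k = 2h + j] of [S] is [x^(2(n-h)+i) y^(2h+j)], so comparison of
   halves gives [x^(n-h) y^h]. *)
have -> : (i + j + n.*2 - k = (n - h).*2 + i)%N.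
  by rewrite kE addnAC subnDr doubleB addnBAC ?leq_double// addnC.
by rewrite kE !double_add_bool_eq !eqxx !andbT.
Qed.

Lemma total_size_polXY_psubst_sq (i j : bool) p n : (total_size p <= n)%N ->
  (total_size (xy i j * psubst_sq p)%R <= i + j + n.*2)%N.
Proof.
move=> /total_size_leP pn; apply/total_size_leP => a b ab.
rewrite -(odd_double_half a) -(odd_double_half b) ![(odd _ + _)%N]addnC.
rewrite coef_polXY_psubst_sq; case: ifP => // /andP[/eqP ia /eqP jb].
rewrite pn// -leq_double doubleD -(leq_add2l (i + j)).
by rewrite (leq_trans ab)// ia jb addnACA !odd_double_half.
Qed.

Lemma polXY_psubst_sq_neq0 (i j : bool) p : p != 0 -> xy i j * psubst_sq p != 0.
Proof.
apply: contraNneq => p0; apply/eqP/coef_eqP => a b.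
have := coef_polXY_psubst_sq i j i j p a b.
by rewrite p0 !mcoeff0 !eqxx.
Qed.

End BigVectorEntries.

(** * Orthogonality and positivity for an abstract linear form *)

Section OrthogonalForm.
Variables (R : realType) (L : {scalar bipoly R}) (S : poly_family R).
Hypothesis monicS : monic_system S.
Hypothesis orthS : forall n m i j, n <> m -> L (S n i 0 * S m j 0) = 0.
Hypothesis sqL : forall p, 0 <= L (p * p).
Hypothesis posS : forall n (v : 'I_n.+1 -> R) i, v i != 0 ->
  0 < L ((\sum_m v m *: S n m 0) * (\sum_m v m *: S n m 0)).
Local Notation coef a b := (mcoeff (bimon a b)).
Local Notation xy i j := (polX R ^+ i * polY R ^+ j).

Lemma orth_lower_degree n k r : (total_size r <= n)%N -> L (S n k 0 * r) = 0.
Proof.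
move=> /(lincomb_span (monic_system_bimonic monicS))[c ->].
rewrite mulr_sumr linear_sum big1// => m _.
rewrite mulr_sumr linear_sum big1// => j _.
rewrite -scalerAr linearZ /= orthS ?mulr0// => nm.
by have := ltn_ord m; rewrite -nm ltnn.
Qed.

Lemma form_sqrD (p q : bipoly R) :
  L (p * q) = 0 -> L ((p + q) * (p + q)) = L (p * p) + L (q * q).
Proof.
by move=> pq; rewrite mulrDr !mulrDl (mulrC q p) !linearD /= pq addr0 add0r.
Qed.

(** Write [f = t + g], where [t] combines the entries of [S N] with the top coefficients of [f] and
    [g] has lower degree. Then [L (t * g) = 0], [L (g * g) >= 0], and [L (t * t) > 0] by [posS]. *)
Lemma form_square_gt0 (f : bipoly R) : f != 0 -> 0 < L (f * f).
Proof.
move=> f0; set N := (total_size f).-1.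
have fN : total_size f = N.+1 by rewrite /N prednK// lt0n msize_poly_eq0.
have := total_size_reduce (monic_system_bimonic monicS) (eq_leq fN).
set t : bipoly R := \sum_(m < _) _; set g : bipoly R := f - t => gN.
have -> : f = t + g by rewrite /g addrC subrK.
have tg0 : L (t * g) = 0.
  rewrite mulr_suml linear_sum big1// => m _.
  by rewrite -scalerAl linearZ /= orth_lower_degree ?mulr0.
rewrite form_sqrD// ltr_wpDr//.
have [/existsP[m vm]|/existsPn v0] :=
  boolP [exists m : 'I_N.+1, coef (N - m) m f != 0]; first exact: posS vm.
(* If all top coefficients vanished, then [t = 0] and [g = f], contradicting the size bound on
   [g]. *)
move: gN; rewrite /g /t big1 ?subr0 ?fN ?ltnn// => m _.
by have := v0 m; rewrite negbK => /eqP ->; rewrite scale0r.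
Qed.

Hypothesis parityL : forall (i j : bool) p, i || j -> L (xy i j * psubst_sq p) = 0.
Variable P : bigvecs R.
Hypothesis SP : big_vector_polynomials S P.

Lemma orth_hatP (i j : bool) n (h : 'I_n.+1) r : (total_size r <= n)%N ->
  L (xy i j ^+ 2 * psubst_sq (hatP P i j n h 0 * r)) = 0.
Proof.
move=> rn; have [k [q [_ Sk]]] := hatP_entry SP i j h.
have := orth_lower_degree k (total_size_polXY_psubst_sq i j rn).
rewrite Sk mulrDl linearD /=.
(* Opposite parities multiply to exactly [x y], whatever [i] and [j], so [parityL] discards this
   product. *)
have -> : xy (~~ i) (~~ j) * psubst_sq q * (xy i j * psubst_sq r) =
    xy true true * psubst_sq (q * r).
  rewrite psubst_sqM mulrACA; congr (_ * _).
  by rewrite mulrACA -!exprD !addNb.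
rewrite parityL// addr0 => <-.
by rewrite psubst_sqM expr2 mulrACA.
Qed.

Lemma form_hatP_square_gt0 (i j : bool) p : p != 0 ->
  0 < L (xy i j ^+ 2 * psubst_sq (p * p)).
Proof.
move=> p0; rewrite psubst_sqM expr2 mulrACA.
exact/form_square_gt0/polXY_psubst_sq_neq0.
Qed.

End OrthogonalForm.

(** * The moment form of a weight and its behaviour under substitution *)

Section MomentForm.
Context {R : realType}.
Local Notation RT := (measurableTypeR R).
Local Notation mu := (leb2 R).
Local Notation xy i j := (polX R ^+ i * polY R ^+ j).
Implicit Types (Omega : set (R * R)) (W : R * R -> R) (p q : bipoly R).

Lemma peval_polXY_psubst_sq i j p z : peval (xy i j * psubst_sq p) z =
  z.1 ^+ i * z.2 ^+ j * peval p (z.1 ^+ 2, z.2 ^+ 2).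
Proof. by rewrite pevalM peval_polXY peval_psubst_sq. Qed.

Definition moment_form Omega W p : R := \int[mu]_(z in Omega) (peval p z * W z).

Lemma integrable_peval Omega W p : weight_function Omega W ->
  mu.-integrable Omega (EFin \o (fun z => peval p z * W z)).
Proof.
move=> [mO _ _ iW].
rewrite (_ : _ \o _ = fun z => (\sum_(m <- msupp p) (mcoeff m p)%:E *
    (z.1 ^+ m ord0 * z.2 ^+ m ord_max * W z)%:E)%E); last first.
  apply/funext => z /=; rewrite pevalE mulr_suml -sumEFin.
  by apply: eq_bigr => m _; rewrite -EFinM !mulrA.
by apply: integrable_sum => // m _; apply: integrableZl => //; exact: iW.
Qed.

Lemma moment_form_linear Omega W : weight_function Omega W ->
  GRing.linear_for *%R (moment_form Omega W).
Proof.
move=> wW c p q; have [mO _ _ _] := wW.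
rewrite /moment_form -RintegralZl//; last exact: integrable_peval.
rewrite -RintegralD//; last 2 first.
- exact: (integrableZl mO c (integrable_peval p wW)).
- exact: integrable_peval.
by apply: eq_Rintegral => z _; rewrite pevalD pevalZ mulrDl mulrA.
Qed.

Lemma gramE Omega W (P : poly_family R) n m (i : 'I_n.+1) (j : 'I_m.+1) :
  gram Omega W P n m i j = moment_form Omega W (P n i 0 * P m j 0).
Proof. by rewrite mxE; apply: eq_Rintegral => z _; rewrite pevalM. Qed.

Lemma gram_sym Omega W (P : poly_family R) n :
  (gram Omega W P n n)^T = gram Omega W P n n.
Proof. by apply/matrixP => i j; rewrite mxE !gramE mulrC. Qed.

(** Translates positive definiteness of Gram matrices into positivity of the form on squares; it
    serves in both directions, for [S] and for [hatP]. *)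
Lemma gram_quadratic_form Omega W (wW : weight_function Omega W)
    (P : poly_family R) n (v : 'cV[R]_n.+1) :
  (v^T *m gram Omega W P n n *m v) 0 0 =
  moment_form Omega W ((\sum_i v i 0 *: P n i 0) * (\sum_i v i 0 *: P n i 0)).
Proof.
pose L : {scalar bipoly R} := HB.pack (moment_form Omega W)
  (GRing.isLinear.Build _ _ _ _ (moment_form Omega W) (moment_form_linear wW)).
rewrite -[RHS]/(L _) mulr_sumr linear_sum mxE; apply: eq_bigr => j _.
rewrite mulr_suml linear_sum mxE mulr_suml; apply: eq_bigr => i _.
have -> : L (v i 0 *: P n i 0 * (v j 0 *: P n j 0)) =
    v i 0 * (v j 0 * L (P n i 0 * P n j 0)).
  by rewrite -scalerAl linearZ -scalerAr linearZ.
by rewrite gramE mxE -mulrA [_ * v j 0]mulrC.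
Qed.

Lemma moment_form_square_ge0 Omega W p : weight_function Omega W ->
  0 <= moment_form Omega W (p * p).
Proof.
move=> [_ W0 _ _]; apply: Rintegral_ge0 => z Oz.
by rewrite pevalM mulr_ge0 ?W0// -expr2 sqr_ge0.
Qed.

(** Reflect [x] if [i] holds, otherwise [y]: the polynomial changes sign while [W] is invariant. *)
Lemma moment_form_odd Omega W (i j : bool) p : weight_function Omega W ->
  xy_symmetric Omega W -> i || j -> moment_form Omega W (xy i j * psubst_sq p) = 0.
Proof.
move=> wW sym ij; have [mO _ _ _] := wW.
have [Ox Oy] := xy_symmetric_oppP sym.
have mid : measurable_fun setT (id : RT -> RT) by [].
have mopp : measurable_fun setT (-%R : RT -> RT) by exact: oppr_measurable.
have ip := integrable_peval (xy i j * psubst_sq p) wW.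
case: i ij ip => /= [_|j1] ip.
  apply: (Rintegral_odd mopp mid _ _ mO) ip => //.
  - by move=> A mA; exact: lebesgue_measureN.
  - by case=> x y; exact: Ox.
  - case=> x y Oxy /=; have [_ _ -> _] := sym _ _ Oxy.
    by rewrite !peval_polXY_psubst_sq /= sqrrN !expr1 !mulNr.
rewrite j1 in ip *.
apply: (Rintegral_odd mid mopp _ _ mO) ip => //.
- by move=> A mA; exact: lebesgue_measureN.
- by case=> x y; exact: Oy.
- case=> x y Oxy /=; have [_ _ _ ->] := sym _ _ Oxy.
  by rewrite !peval_polXY_psubst_sq /= sqrrN !expr1 mulrN !mulNr.
Qed.

(** The identity [sqrt a = a / sqrt a] brings the four weights to one shape, in which the
    substitution factor is isolated. *)
Lemma WijE W (i j : bool) z : 0 <= z.1 -> 0 <= z.2 ->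
  Wij W i j z = z.1 ^+ i * z.2 ^+ j * (4^-1 * W (sqrt_pair z)) * inv_sqrt_pair z.
Proof.
case: z => x y /= x0 y0; rewrite /Wij /sqrt_pair /inv_sqrt_pair /=.
(* Holds for [a = 0] too, since [0^-1 = 0]. *)
have sV (a : R) : 0 <= a -> Num.sqrt a = a * (Num.sqrt a)^-1.
  move=> a0; rewrite -{2}(sqr_sqrtr a0) expr2.
  by have [->|sa0] := eqVneq (Num.sqrt a) 0; rewrite ?mul0r ?mulfK.
set w := W _; case: i j => -[]; rewrite ?expr1 ?expr0.
- by rewrite sqrtrM// {1}(sV x x0) {1}(sV y y0); ring.
- by rewrite sqrtrM// sqrtrV// {1}(sV x x0); ring.
- by rewrite sqrtrM// sqrtrV// {1}(sV y y0); ring.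
- by rewrite sqrtrM// div1r invfM; ring.
Qed.

Lemma moment_form_star Omega W (i j : bool) p : weight_function Omega W ->
  xy_symmetric Omega W ->
  mu.-integrable (Omega_star Omega) (EFin \o (fun z => peval p z * Wij W i j z)) /\
  moment_form (Omega_star Omega) (Wij W i j) p =
    4^-1 * moment_form Omega W (xy i j ^+ 2 * psubst_sq p).
Proof.
move=> wW sym; have [mO _ _ _] := wW.
set q := xy i j ^+ 2 * psubst_sq p.
(* The 1/4 goes into [h] because [Wij] contains it and [inv_sqrt_pair] does not. Since [q] has only
   even exponents, [h] inherits the symmetry of [W]. *)
pose h z := 4^-1 * (peval q z * W z).
have iq : mu.-integrable Omega (EFin \o (fun z => peval q z * W z)).
  exact: integrable_peval.
have ih : mu.-integrable Omega (EFin \o h).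
  exact: (integrableZl mO 4^-1 iq).
have peval_q x y : peval q (x, y) = (x ^+ i * y ^+ j) ^+ 2 * peval p (x ^+ 2, y ^+ 2).
  by rewrite /q pevalM peval_psubst_sq expr2 pevalM peval_polXY -expr2.
have symh : xy_symmetric Omega h.
  move=> x y Oxy; have [Ox Oy Wx Wy] := sym x y Oxy.
  split=> //; rewrite /h ?Wx ?Wy !peval_q; congr (_ * (_ * _)).
    by rewrite !exprMn -!exprM ![(_ * 2)%N]mulnC !exprM sqrrN.
  by rewrite !exprMn -!exprM ![(_ * 2)%N]mulnC !exprM sqrrN.
have hE z : Omega_star Omega z ->
    h (sqrt_pair z) * inv_sqrt_pair z = peval p z * Wij W i j z.
  case: z => x y [/= x0 y0 Oz]; rewrite WijE// /h /sqrt_pair peval_q !sqr_sqrtr//=.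
  rewrite exprMn -!exprM ![(_ * 2)%N]mulnC !exprM !sqr_sqrtr//.
  by ring.
have [istar Istar] := integrable_sqrt_pair mO symh ih; split.
  apply: eq_integrable istar; first exact: measurable_Omega_star.
  by move=> z /set_mem Oz /=; rewrite hE.
rewrite /moment_form -RintegralZl// -[RHS]Istar.
by apply: eq_Rintegral => z /set_mem Oz; rewrite hE.
Qed.

End MomentForm.

Theorem theorem4p1 (R : realType) (Omega : set (R * R)) (W : R * R -> R)
    (S : poly_family R) (P : bigvecs R) :
  weight_function Omega W ->
  xy_symmetric Omega W ->
  mops Omega W S ->
  big_vector_polynomials S P ->
  (forall i j : bool,
     weight_function (Omega_star Omega) (Wij W i j) /\
     mops (Omega_star Omega) (Wij W i j) (hatP P i j)) /\
  (forall z : R * R, Omega_star Omega z ->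
     [/\ Wij W true false z = z.1 * Wij W false false z,
         Wij W false true z = z.2 * Wij W false false z &
         Wij W true true z = z.1 * z.2 * Wij W false false z]).
Proof.
move=> wW symW [monicS gramS posS] SP; split; last first.
  move=> z [z1 z2 _]; rewrite !WijE// !expr1 !expr0 !mulr1 !mul1r.
  by split; rewrite ?mulrA.
have [mO W0 _ _] := wW.
pose L : {scalar bipoly R} := HB.pack (moment_form Omega W)
  (GRing.isLinear.Build _ _ _ _ (moment_form Omega W) (moment_form_linear wW)).
have orthL n m (i : 'I_n.+1) (j : 'I_m.+1) : n <> m -> L (S n i 0 * S m j 0) = 0.
  by move=> nm; rewrite -[LHS]gramE gramS// mxE.
have sqL p : 0 <= L (p * p) by exact: moment_form_square_ge0.
have posL n (v : 'I_n.+1 -> R) i : v i != 0 ->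
    0 < L ((\sum_m v m *: S n m 0) * (\sum_m v m *: S n m 0)).
  move=> vi; have := (posS n).2 (\col_m v m).
  rewrite gram_quadratic_form//.
  under eq_bigr do rewrite mxE.
  by apply; apply: contraNneq vi => /matrixP/(_ i 0); rewrite !mxE => ->.
have parL (i j : bool) p : i || j -> L (polX R ^+ i * polY R ^+ j * psubst_sq p) = 0.
  exact: moment_form_odd.
move=> i j.
have Wstar p := moment_form_star i j p wW symW.
have posWij p : p != 0 -> 0 < moment_form (Omega_star Omega) (Wij W i j) (p * p).
  move=> p0; rewrite (Wstar _).2 mulr_gt0// ?invr_gt0//.
  exact: (form_hatP_square_gt0 (L := L) monicS).
have wWij : weight_function (Omega_star Omega) (Wij W i j).
  split.
  - exact: measurable_Omega_star.
  - move=> z [z1 z2 Oz]; rewrite WijE// !mulr_ge0 ?inv_sqrt_pair_ge0//.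
    + by rewrite exprn_ge0.
    + by rewrite exprn_ge0.
    + exact: W0.
  (* The total mass is the form at the square of the constant 1. *)
  - have := posWij 1 (oner_neq0 _); congr (_ < _).
    apply: eq_Rintegral => z _.
    by rewrite mulr1 /peval meval1 mul1r.
  - move=> h k; have [+ _] := Wstar (polX R ^+ h * polY R ^+ k).
    by under eq_fun do rewrite peval_polXY.
split=> //.
have monicP := hatP_bimonic monicS SP.
have orthP n m (h : 'I_n.+1) (k : 'I_m.+1) : (m < n)%N ->
    moment_form (Omega_star Omega) (Wij W i j) (hatP P i j n h 0 * hatP P i j m k 0) = 0.
  move=> mn; rewrite (Wstar _).2.
  rewrite [X in _ * X](orth_hatP (L := L) monicS orthL parL SP) ?mulr0//.
  by rewrite (monic_total_size (P := hatP P i j) (monicP i j)).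
split.
- exact: (monic_systemP (monicP i j)).
- move=> n m /eqP; rewrite neq_ltn => nm; apply/matrixP => h k.
  rewrite gramE [RHS]mxE; case/orP: nm => nm; last exact: orthP.
  by rewrite mulrC orthP.
- move=> n; split; first exact: gram_sym.
  move=> v v0; rewrite gram_quadratic_form//; apply: posWij.
  (* If the combination with coefficients [v] is zero, its coefficient at [x^(n-h) y^h], which is
     the entry [h] of [v], vanishes. *)
  apply: contraNneq v0 => r0; apply/eqP/matrixP => h k.
  rewrite (ord1 k) mxE.
  have hn : (n - h + h)%N = n by rewrite subnK// -ltnS.
  have := coef_top_comb (P := hatP P i j) (monicP i j) (fun m => v m 0) hn.
  by rewrite r0 mcoeff0 inord_val => <-.
Qed.
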